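(* There exist computable functions $I_1,I_2,I_3$ from the positive integers to the positive integers such that, for every positive integer $m$, every odd perfect number $n$ with exactly $m$ distinct prime factors, and every $k\in\{1,2,3\}$ with $k\le m$, the $k$-th smallest prime factor of $n$ is less than the prime $p_{I_k(m)}$. (That is, the first, second and third prime factors of $n$ are less than primes $p_{I_1},p_{I_2},p_{I_3}$ respectively, which can be determined from $m$ alone.)
   Context: A positive integer $n$ is perfect if $\sigma(n)=2n$, where $\sigma(n)$ denotes the sum of all positive divisors of $n$; an odd perfect number is an odd positive integer that is perfect. $p_r$ denotes the $r$-th prime ($p_1=2$, $p_2=3$, $\dots$). The distinct prime factors of $n$ are listed in increasing order, so the ''$k$-th smallest prime factor'' refers to the $k$-th element of this list. *)

(* Defs.v *)
From mathcomp Require Import all_boot.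

Set Implicit Arguments.
Unset Strict Implicit.
Unset Printing Implicit Defensive.

Definition sigma (n : nat) : nat := \sum_(d <- divisors n) d.

Definition perfect (n : nat) : Prop := 0 < n /\ sigma n = 2 * n.

Definition odd_perfect (n : nat) : Prop := odd n /\ perfect n.

Lemma next_prime_exists (n : nat) : exists p, (n < p) && prime p.
Proof. by have [p ltnp pr_p] := prime_above n; exists p; rewrite ltnp. Qed.

Definition next_prime (n : nat) : nat := ex_minn (next_prime_exists n).

(* One-based: nth_prime 1 = 2, nth_prime 2 = 3; the value nth_prime 0 = 0 is
   not a prime. *)
Definition nth_prime (r : nat) : nat := iter r next_prime 0.

(* One-based, for 1 <= k <= size (primes n); primes n is duplicate-free and
   increasing. *)
Definition kth_prime_factor (k n : nat) : nat := nth 0 (primes n) k.-1.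

(* Kleene's partial recursive functions, as codes indexed by their arity. *)
Inductive recfun : nat -> Type :=
| RZero n : recfun n
| RSucc : recfun 1
| RProj n (i : 'I_n) : recfun n
| RComp m n (g : recfun m) (h : 'I_m -> recfun n) : recfun n
| RPrec n (g : recfun n) (h : recfun n.+2) : recfun n.+1
| RMin n (g : recfun n.+1) : recfun n.

(* The graph of the partial function denoted by a code: computes f v y holds
   when f is defined at v with value y. In the RPrec case, s lists the
   successive values of the recursion, whose argument is the head of v; in the
   RMin case, g must be defined and nonzero at every argument below y. *)
Fixpoint computes n (f : recfun n) : n.-tuple nat -> nat -> Prop :=
  match f in recfun n return n.-tuple nat -> nat -> Prop with
  | RZero n => fun _ y => y = 0
  | RSucc => fun v y => y = (thead v).+1
  | RProj n i => fun v y => y = tnth v i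
  | RComp m n g h => fun v y =>
      exists2 w : m.-tuple nat,
        forall i, computes (h i) v (tnth w i) & computes g w y
  | RPrec n g h => fun v y =>
      exists s : nat -> nat,
        [/\ computes g [tuple of behead v] (s 0),
            forall i, i < thead v ->
              computes h [tuple of i :: s i :: behead v] (s i.+1)
          & y = s (thead v)]
  | RMin n g => fun v y =>
      computes g [tuple of y :: v] 0 /\
      forall i, i < y -> exists z, computes g [tuple of i :: v] z.+1
  end.

(* A computable function from the positive integers to the positive integers;
   the value of F at 0 is irrelevant. *)
Definition computable_pos (F : nat -> nat) : Prop :=
  (forall m, 0 < m -> 0 < F m) /\
  exists f : recfun 1, forall m, 0 < m -> computes f [tuple m] (F m).

(* Main.v *)
Require Import Defs.
From mathcomp Require Import all_boot zify.

(** Write sigma(n)/n as the product of sigma(p^a)/p^a over the prime powers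
    exactly dividing n.  Each factor is below p/(p-1), so a perfect number
    satisfies 2 <= prod p/(p-1) over its prime factors ([sigma_bound]).

    Split the increasing list p_1 < ... < p_m of prime factors of an odd perfect
    number in front of p_k, with k <= 3.  At most two primes come before p_k, the
    first at least 3 and the second at least 5, so they contribute at most
    (3/2)(5/4) = 15/8 ([head_bound]).  Since 15/8 < 2, the remaining primes
    contribute at least 16/15.  But a strictly increasing list of l integers
    starting at q contributes at most the telescoping product
    q/(q-1) * (q+1)/q * ... = (q-1+l)/(q-1) ([telescoping_bound]).  With q = p_k
    and l <= m this gives 16(q-1) <= 15(q-1+m), that is, q <= 15m+1 <= 16m.  As
    the r-th prime exceeds r, the single primitive recursive function 16m serves
    for all three values of k.  The argument stops at the third prime because
    (3/2)(5/4)(7/6) > 2.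

    All the inequalities are stated over the natural numbers with denominators
    cleared: a bound on the product of p/(p-1) over a list s compares the
    products of p and of p-1 over s. *)

(** Every divisor of n is p^i d with i at most the exponent of p in n and d a
    divisor of the p'-part of n.  Only this inclusion is needed for an upper
    bound on the sum; the powers of p then sum to a geometric series. *)
Lemma sigma_remove_prime p n : prime p -> 0 < n ->
  sigma n * p.-1 <= p * n`_p * sigma n`_p^'.
Proof.
move=> p_pr n_gt0; set a := logn p n.
have p_gt0 := prime_gt0 p_pr.
have le_sigma : sigma n <= (\sum_(i < a.+1) p ^ i) * sigma n`_p^'.
  pose F := [seq p ^ i * d | i <- iota 0 a.+1, d <- divisors n`_p^'].
  have -> : (\sum_(i < a.+1) p ^ i) * sigma n`_p^' = \sum_(x <- F) x.
    rewrite big_allpairs_dep /sigma big_distrl /=.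
    rewrite -(big_mkord xpredT
      (fun i => p ^ i * \sum_(d <- divisors n`_p^') d)) /index_iota subn0.
    by apply: eq_bigr => i _; rewrite big_distrr.
  apply: (@sub_le_big_seq _ _ leq) => // [x y|d]; first exact: leq_addr.
  rewrite count_uniq_mem ?divisors_uniq // -dvdn_divisors //.
  case: (boolP (d %| n)) => // dvd_d; rewrite -has_count has_pred1.
  have d_gt0 := dvdn_gt0 n_gt0 dvd_d.
  rewrite -(partnC p d_gt0) p_part; apply: allpairs_f.
    by rewrite mem_iota ltnS /= dvdn_leq_log.
  by rewrite -dvdn_divisors ?part_gt0 // partn_dvd.
apply: (leq_trans (leq_mul le_sigma (leqnn _))).
rewrite mulnAC leq_mul2r [_ * p.-1]mulnC -predn_exp p_part -expnS.
by rewrite leq_pred orbT.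
Qed.

(** This is sigma(n)/n <= prod p/(p-1), by splitting off one prime power at a
    time; the induction is on the list of primes, because the list for the
    p'-part of n is the list for n without its head p. *)
Lemma sigma_bound n : 0 < n ->
  sigma n * \prod_(p <- primes n) p.-1 <= n * \prod_(p <- primes n) p.
Proof.
move En: (primes n) => s; elim: s n En => [|p s IHs] n En n_gt0.
  move/eqP: En; rewrite primes_eq0 => n_lt2.
  have -> : n = 1 by lia.
  by rewrite /sigma !big_nil (_ : divisors 1 = [:: 1]) // big_seq1.
have p_pr : prime p.
  by have := mem_head p s; rewrite -En mem_primes => /andP[].
have Es : primes n`_p^' = s.
  have := primes_uniq n; rewrite primes_part En /= => /andP[p_notin _].
  rewrite !inE eqxx /=; apply/all_filterP/allP => x x_s.
  by rewrite !inE; apply: contraNneq p_notin => <-.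
have IH := IHs _ Es (part_gt0 _ _).
have := sigma_remove_prime _ _ p_pr n_gt0.
rewrite !big_cons; set P := \prod_(_ <- s) _.-1; set Q := \prod_(_ <- s) _.
rewrite -/P -/Q in IH.
move=> le_p; rewrite mulnA.
apply: leq_trans (leq_mul le_p (leqnn P)) _.
rewrite -[X in _ <= X * _](partnC p n_gt0) -mulnA.
apply: leq_trans (leq_mul (leqnn _) IH) _.
by rewrite [p * _]mulnC mulnACA leqnn.
Qed.

(** The i-th entry of s, counted from 0, is at least r+1+i, so its factor p/(p-1)
    is at most (r+1+i)/(r+i), and the product of these bounds telescopes to
    (r + size s)/r when r > 0.  The induction applies the bound for the tail
    with the head in place of r, so r need not be one less than the head. *)
Lemma telescoping_bound r s : path ltn r s ->
  r * \prod_(p <- s) p <= (r + size s) * \prod_(p <- s) p.-1.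
Proof.
elim: s r => [|p s IHs] r /=; first by rewrite !big_nil addn0.
case/andP=> lt_rp /IHs; rewrite !big_cons.
move: (\prod_(j <- s) j) (\prod_(j <- s) j.-1) => P Q IH.
apply: (@leq_trans (r * ((p + size s) * Q))); first by rewrite leq_mul2l IH orbT.
rewrite !mulnA leq_mul2r; apply/orP; right.
rewrite -(subnKC lt_rp); move: (p - r.+1) (size s) => e l.
by rewrite addSn /=; nia.
Qed.

(** 15/8 = (3/2)(5/4) is attained at the two smallest odd primes 3 and 5. *)
Lemma head_bound s : sorted ltn s -> all odd s -> all (ltn 1) s ->
  size s <= 2 -> 8 * \prod_(p <- s) p <= 15 * \prod_(p <- s) p.-1.
Proof.
case: s => [|p [|q []]] //= lt_s odd_s gt1_s _; rewrite ?big_cons !big_nil //.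
  by lia.
have p_bound : 2 * p <= 3 * p.-1 by lia.
have q_bound : 4 * q <= 5 * q.-1 by lia.
by have := leq_mul p_bound q_bound; lia.
Qed.

Lemma odd_perfect_factor_bound n k : odd_perfect n -> k <= 2 ->
  k < size (primes n) -> nth 0 (primes n) k <= 16 * size (primes n).
Proof.
case=> odd_n [n_gt0 sigma_n] k_le2 lt_k; set s := primes n in lt_k *.
have prime_s p : p \in s -> prime p by rewrite mem_primes => /andP[].
have sorted_s : sorted ltn s := sorted_primes n.
have odd_s : all odd s.
  apply/allP=> p; rewrite mem_primes => /and3P[_ _ /dvdn_odd]; exact.
have gt1_s : all (ltn 1) s by apply/allP=> p /prime_s/prime_gt1.
have P_gt0 t : {subset t <= s} -> 0 < \prod_(p <- t) p.-1.
  move=> sub_ts; rewrite big_seq prodn_cond_gt0 // => p /sub_ts/prime_s.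
  by move/prime_gt1; case: p => [|[]].
have abundancy : 2 * \prod_(p <- s) p.-1 <= \prod_(p <- s) p.
  have := sigma_bound n n_gt0; rewrite sigma_n -/s.
  by rewrite -mulnA mulnCA leq_pmul2l.
have head : 8 * \prod_(p <- take k s) p <= 15 * \prod_(p <- take k s) p.-1.
  apply: head_bound; last by rewrite size_take lt_k.
  - exact: take_sorted.
  - by apply/allP=> p /mem_take; apply/allP.
  - by apply/allP=> p /mem_take; apply/allP.
set q := nth 0 s k.
have q_gt0 : 0 < q by apply/prime_gt0/prime_s/mem_nth.
have tail : q.-1 * \prod_(p <- drop k s) p
            <= (q.-1 + size s) * \prod_(p <- drop k s) p.-1.
  apply: leq_trans (telescoping_bound _ _ _) _.
    have := drop_sorted k sorted_s; rewrite (drop_nth 0 lt_k) /= -/q => ->.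
    by rewrite prednK ?leqnn.
  by rewrite leq_mul2r leq_add2l size_drop leq_subr orbT.
have T_gt0 := P_gt0 _ (@mem_take k _ s); have D_gt0 := P_gt0 _ (@mem_drop k _ s).
move: abundancy head tail T_gt0 D_gt0.
rewrite -{1 2}(cat_take_drop k s) !big_cat /=.
move: (\prod_(_ <- take k s) _) (\prod_(_ <- take k s) _.-1) => A B.
move: (\prod_(_ <- drop k s) _) (\prod_(_ <- drop k s) _.-1) => C D.
move=> abundancy head tail B_gt0 D_gt0.
have : 16 * q.-1 * (B * D) <= 15 * (q.-1 + size s) * (B * D).
  (* 8 times the abundancy bound, then the head bound times the tail bound. *)
  apply: (@leq_trans (8 * q.-1 * (A * C))); first by nia.
  by have := leq_mul head tail; lia.
by rewrite leq_pmul2r ?muln_gt0 ?B_gt0 //; lia.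
Qed.

Lemma ltn_next_prime n : n < next_prime n.
Proof. by rewrite /next_prime; case: ex_minnP => p /andP[]. Qed.

Lemma ltn_nth_prime r : 0 < r -> r < nth_prime r.
Proof.
case: r => // r _; elim: r => [|r IHr] /=; last first.
  exact: leq_ltn_trans IHr (ltn_next_prime _).
by rewrite /next_prime; case: ex_minnP => p /andP[_ /prime_gt1].
Qed.

(** The step of the primitive recursion for multiplication by c: its arguments
    are the counter and the previous value, the latter at index 1. *)
Definition add_const_code c : recfun 2 :=
  iter c (fun f => RComp RSucc (fun=> f)) (RProj (@Ordinal 2 1 isT)).

Lemma computes_add_const c (v : 2.-tuple nat) :
  computes (add_const_code c) v (c + tnth v (@Ordinal 2 1 isT)).
Proof.
elim: c => [|c IHc] //=; exists [tuple c + tnth v (@Ordinal 2 1 isT)] => //.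
by move=> i; rewrite ord1.
Qed.

Lemma computable_mul_const c : 0 < c -> computable_pos (muln c).
Proof.
move=> c_gt0; split=> [m m_gt0|]; first by rewrite muln_gt0 c_gt0.
exists (RPrec (RZero 0) (add_const_code c)) => m _ /=.
exists (muln c); split=> [||//]; first by rewrite muln0.
by move=> i _; rewrite mulnS; apply: computes_add_const.
Qed.

Theorem theorem3p2 :
  exists I1 I2 I3 : nat -> nat,
    [/\ computable_pos I1, computable_pos I2, computable_pos I3
      & forall m n : nat, 0 < m -> odd_perfect n -> size (primes n) = m ->
        [/\ 1 <= m -> kth_prime_factor 1 n < nth_prime (I1 m),
            2 <= m -> kth_prime_factor 2 n < nth_prime (I2 m)
          & 3 <= m -> kth_prime_factor 3 n < nth_prime (I3 m)]].
Proof.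
have comp16 := computable_mul_const 16 isT.
exists (muln 16), (muln 16), (muln 16); split=> // m n m_gt0 perf_n size_n.
have lt_factor k : k <= 2 -> k < m -> nth 0 (primes n) k < nth_prime (16 * m).
  rewrite -size_n => k_le2 lt_k.
  apply: leq_ltn_trans (odd_perfect_factor_bound n k perf_n k_le2 lt_k) _.
  by apply: ltn_nth_prime; rewrite size_n muln_gt0.
by split; apply: lt_factor.
Qed.
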